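(* Let $S'\to S$ be a surjective finite étale morphism of schemes which is a Galois cover with Galois group $\Gamma$, and let $\mathcal X'$ be a stack over $S'$. Then a group action of $\Gamma$ on the stack $\mathcal X'$ over $S$, such that for each $\sigma\in\Gamma$ the square formed by the isomorphism $\sigma\colon\mathcal X'\to\mathcal X'$ attached to $\sigma$ by the action, the morphism $\sigma\colon S'\to S'$, and the structure morphism $\mathcal X'\to S'$ (on both sides) commutes, determines in a canonical way a Galois $2$-descent datum for $\mathcal X'$.
   Context: Stacks. A stack over a scheme $S$ is a stack in groupoids over the big fppf site $(\mathrm{Sch}/S)_{fppf}$; an isomorphism ($1$-isomorphism) of stacks over $S$ is an equivalence of categories over $\mathrm{Sch}/S$. A stack $\mathcal X'$ over $S'$ is regarded as a stack over $S$ via $S'\to S$. Group action. An action of a finite group $\Gamma$ on a stack $\mathcal Y$ over $S$ consists of isomorphisms $\mu(\sigma)\colon\mathcal Y\to\mathcal Y$ of stacks over $S$ ($\sigma\in\Gamma$; also written simply $\sigma\colon\mathcal Y\to\mathcal Y$), $2$-isomorphisms $\alpha_{\tau,\sigma}\colon\mu(\tau)\circ\mu(\sigma)\Rightarrow\mu(\tau\sigma)$ ($\tau,\sigma\in\Gamma$) and a $2$-isomorphism $\beta\colon\mu(e)\Rightarrow\mathrm{id}_{\mathcal Y}$, such that for all $\gamma,\tau,\sigma\in\Gamma$ the composition $\mu(\gamma)\circ\mu(\tau)\circ\mu(\sigma)\Rightarrow\mu(\gamma\tau)\circ\mu(\sigma)\Rightarrow\mu(\gamma\tau\sigma)$ equals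 the composition $\mu(\gamma)\circ\mu(\tau)\circ\mu(\sigma)\Rightarrow\mu(\gamma)\circ\mu(\tau\sigma)\Rightarrow\mu(\gamma\tau\sigma)$, the $2$-morphism $\mu(\sigma)\circ\mu(e)\Rightarrow\mu(\sigma)$ induced by $\beta$ equals $\alpha_{\sigma,e}$, and the $2$-morphism $\mu(e)\circ\mu(\sigma)\Rightarrow\mu(\sigma)$ induced by $\beta$ equals $\alpha_{e,\sigma}$. Galois $2$-descent datum. The finite group $\Gamma$ acts on the left on $S'$ over $S$, and Galois with group $\Gamma$ means that $\Gamma\times S'\to S'\times_S S'$, $(\sigma,x)\mapsto(\sigma x,x)$, is an isomorphism. For $\sigma\in\Gamma$, ${}^\sigma\mathcal X'=\mathcal X'\times_{S',\sigma}S'$ is the pull-back of $\mathcal X'$ along $\sigma\colon S'\to S'$, viewed as a stack over $S'$ via the pull-back of $\mathcal X'\to S'$; the superscript ${}^\sigma(-)$ on morphisms and $2$-morphisms also denotes pull-back along $\sigma$, and ${}^\sigma({}^\tau\mathcal X')={}^{\tau\sigma}\mathcal X'$ canonically. A Galois $2$-descent datum for $\mathcal X'$ consists of a family of $1$-isomorphisms of $S'$-stacks $f_\sigma\colon{}^\sigma\mathcal X'\xrightarrow{\sim}\mathcal X'$ ($\sigma\in\Gamma$) and a family of $2$-isomorphisms $\psi_{\tau,\sigma}\colon f_\sigma\circ{}^\sigma f_\tau\Rightarrow f_{\tau\sigma}$ ($(\tau,\sigma)\in\Gamma\times\Gamma$) such that for all $(\gamma,\tau,\sigma)\in\Gamma\times\Gamma\times\Gamma$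 the composites $$f_\sigma\circ{}^\sigma f_\tau\circ{}^{\tau\sigma}f_\gamma\overset{\psi_{\tau,\sigma}}{\Rightarrow} f_{\tau\sigma}\circ{}^{\tau\sigma}f_\gamma\overset{\psi_{\gamma,\tau\sigma}}{\Rightarrow} f_{\gamma\tau\sigma},\qquad f_\sigma\circ{}^\sigma f_\tau\circ{}^{\tau\sigma}f_\gamma\overset{{}^\sigma\psi_{\gamma,\tau}}{\Rightarrow} f_\sigma\circ{}^\sigma f_{\gamma\tau}\overset{\psi_{\gamma\tau,\sigma}}{\Rightarrow} f_{\gamma\tau\sigma}$$ coincide (where the first arrow of each composite is the $2$-morphism induced by the indicated one). *)

(* Defs.v *)
From HB Require Import structures.
From mathcomp Require Import all_boot all_order all_algebra all_fingroup.
From mathcomp Require Import boolp classical_sets filter topology_structure.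

Set Implicit Arguments.
Unset Strict Implicit.
Unset Printing Implicit Defensive.

Import GRing.Theory.

Declare Scope cat_scope.
Delimit Scope cat_scope with cat.

Record category := Category {
  obj :> Type;
  hom : obj -> obj -> Type;
  id_hom : forall a, hom a a;
  cmp : forall a b c, hom b c -> hom a b -> hom a c;
  cmpA : forall a b c d (h : hom c d) (g : hom b c) (f : hom a b),
    cmp h (cmp g f) = cmp (cmp h g) f;
  cmp1m : forall a b (f : hom a b), cmp (id_hom b) f = f;
  cmpm1 : forall a b (f : hom a b), cmp f (id_hom a) = f }.

Arguments id_hom {c} a : rename.
Arguments cmp {c a b c0} _ _ : rename.

Notation "g ∘ f" := (cmp g f) (at level 40, left associativity) : cat_scope.
Local Open Scope cat_scope.

Definition is_isom (C : category) (a b : C) (f : hom a b) : Prop :=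
  exists g : hom b a, g ∘ f = id_hom a /\ f ∘ g = id_hom b.

Definition is_fibre_product (C : category) (a b s p : C)
    (f : hom a s) (g : hom b s) (p1 : hom p a) (p2 : hom p b) : Prop :=
  f ∘ p1 = g ∘ p2 /\
  forall t (u : hom t a) (v : hom t b), f ∘ u = g ∘ v ->
    exists! w : hom t p, p1 ∘ w = u /\ p2 ∘ w = v.

Definition is_coproduct (C : category) (I : Type) (a : I -> C) (p : C)
    (inj : forall i, hom (a i) p) : Prop :=
  forall t (u : forall i, hom (a i) t),
    exists! w : hom p t, forall i, w ∘ inj i = u i.

Section Slice.
Variables (C : category) (S : C).

#[projections(primitive)]
Record slice_obj := SliceObj { sdom : C; sstr : hom sdom S }.

Record slice_hom (a b : slice_obj) := SliceHom {
  shom : hom (sdom a) (sdom b);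
  shomE : sstr b ∘ shom = sstr a }.

Lemma slice_hom_eq a b (f g : slice_hom a b) : shom f = shom g -> f = g.
Proof.
case: f g => [f ef] [g eg] /= efg; move: ef eg; rewrite efg => ef eg.
by rewrite (Prop_irrelevance ef eg).
Qed.

Definition slice_id a : slice_hom a a := SliceHom (cmpm1 (sstr a)).

Lemma slice_cmp_subproof a b c (g : slice_hom b c) (f : slice_hom a b) :
  sstr c ∘ (shom g ∘ shom f) = sstr a.
Proof. by rewrite cmpA !shomE. Qed.

Definition slice_cmp a b c (g : slice_hom b c) (f : slice_hom a b) :=
  SliceHom (slice_cmp_subproof g f).

Definition slice : category.
Proof.
refine (@Category slice_obj slice_hom slice_id slice_cmp _ _ _).
- by move=> *; apply: slice_hom_eq; apply: cmpA.
- by move=> *; apply: slice_hom_eq; apply: cmp1m.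
- by move=> *; apply: slice_hom_eq; apply: cmpm1.
Defined.

End Slice.

(* A functor p : X -> B, presented with its objects sorted by their image:
   [X a] is the class {x | p x = a}, and [fhom x y] is the set of all morphisms
   x -> y of X, on which p is [fproj].  A functor over B can then be required to
   commute with the projections strictly, without transport along equalities
   between objects of B. *)
Record cat_over (B : category) := CatOver {
  fob :> B -> Type;
  fhom : forall a b, fob a -> fob b -> Type;
  fproj : forall a b (x : fob a) (y : fob b), fhom x y -> hom a b;
  fid : forall a (x : fob a), fhom x x;
  fcmp : forall a b c (x : fob a) (y : fob b) (z : fob c),
    fhom y z -> fhom x y -> fhom x z;
  fproj_id : forall a (x : fob a), fproj (fid x) = id_hom a;
  fproj_cmp : forall a b c (x : fob a) (y : fob b) (z : fob c)
    (g : fhom y z) (f : fhom x y), fproj (fcmp g f) = fproj g ∘ fproj f;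
  fcmpA : forall a b c d (x : fob a) (y : fob b) (z : fob c) (t : fob d)
    (h : fhom z t) (g : fhom y z) (f : fhom x y),
    fcmp h (fcmp g f) = fcmp (fcmp h g) f;
  fcmp1m : forall a b (x : fob a) (y : fob b) (f : fhom x y),
    fcmp (fid y) f = f;
  fcmpm1 : forall a b (x : fob a) (y : fob b) (f : fhom x y),
    fcmp f (fid x) = f }.

Arguments fhom {B c a b} _ _ : rename.
Arguments fproj {B c a b x y} _ : rename.
Arguments fid {B c a} x : rename.
Arguments fcmp {B c a b c0 x y z} _ _ : rename.

Notation "g ∙ f" := (fcmp g f) (at level 40, left associativity) : cat_scope.

Record over_functor (B : category) (X Y : cat_over B) := OverFunctor {
  fun_ob :> forall a, X a -> Y a;
  fun_hom : forall a b (x : X a) (y : X b), fhom x y -> fhom (fun_ob x) (fun_ob y);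
  fun_proj : forall a b (x : X a) (y : X b) (f : fhom x y),
    fproj (fun_hom f) = fproj f;
  fun_id : forall a (x : X a), fun_hom (fid x) = fid (fun_ob x);
  fun_cmp : forall a b c (x : X a) (y : X b) (z : X c)
    (g : fhom y z) (f : fhom x y), fun_hom (g ∙ f) = fun_hom g ∙ fun_hom f }.

Arguments fun_ob {B X Y} o a x : rename.
Arguments fun_hom {B X Y} o {a b x y} f : rename.

Section Functors.
Variable B : category.

Definition id_functor (X : cat_over B) : over_functor X X.
Proof. exact: (@OverFunctor B X X (fun a x => x) (fun a b x y f => f)). Defined.

Definition comp_functor (X Y Z : cat_over B)
  (G : over_functor Y Z) (F : over_functor X Y) : over_functor X Z.
Proof.
refine (@OverFunctor B X Z (fun a x => G a (F a x))
         (fun a b x y f => fun_hom G (fun_hom F f)) _ _ _).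
- by move=> *; rewrite !fun_proj.
- by move=> *; rewrite !fun_id.
- by move=> *; rewrite !fun_cmp.
Defined.

Record two_iso (X Y : cat_over B) (F G : over_functor X Y) := TwoIso {
  tcomp :> forall a (x : X a), fhom (F a x) (G a x);
  tcomp_proj : forall a (x : X a), fproj (tcomp x) = id_hom a;
  tcomp_nat : forall a b (x : X a) (y : X b) (f : fhom x y),
    tcomp y ∙ fun_hom F f = fun_hom G f ∙ tcomp x;
  tcomp_inv : forall a (x : X a), exists t : fhom (G a x) (F a x),
    t ∙ tcomp x = fid (F a x) /\ tcomp x ∙ t = fid (G a x) }.

Definition is_equivalence (X Y : cat_over B) (F : over_functor X Y) : Prop :=
  exists G : over_functor Y X,
    inhabited (two_iso (comp_functor G F) (id_functor X)) /\
    inhabited (two_iso (comp_functor F G) (id_functor Y)).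

End Functors.

Arguments tcomp {B X Y F G} t a x : rename.
Notation "G ∘F F" := (comp_functor G F) (at level 40, left associativity) : cat_scope.

Section Stack.
Variable B : category.

Record fibred_in_groupoids (X : cat_over B) : Prop := FibredInGroupoids {
  fib_lift : forall a b (f : hom a b) (y : X b),
    exists (x : X a) (phi : fhom x y), fproj phi = f;
  fib_cart : forall a b c (x : X a) (y : X b) (z : X c)
    (phi : fhom y z) (psi : fhom x z) (g : hom a b),
    fproj phi ∘ g = fproj psi ->
    exists! chi : fhom x y, fproj chi = g /\ phi ∙ chi = psi }.

Definition sieve (a : B) := forall c, hom c a -> Prop.

Definition generated_sieve (a : B) (I : Type) (b : I -> B)
    (f : forall i, hom (b i) a) : sieve a :=
  fun c g => exists i (h : hom c (b i)), g = f i ∘ h.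

(* A functor over B from the full subcategory of B/a on the sieve R to X. *)
Record descent_datum (X : cat_over B) (a : B) (R : sieve a) := DescentDatum {
  dd_ob : forall c (g : hom c a), R c g -> X c;
  dd_hom : forall c c' (g : hom c a) (g' : hom c' a) (r : R c g) (r' : R c' g')
    (h : hom c' c), g ∘ h = g' -> fhom (dd_ob r') (dd_ob r);
  dd_proj : forall c c' (g : hom c a) (g' : hom c' a) (r : R c g) (r' : R c' g')
    (h : hom c' c) (e : g ∘ h = g'), fproj (dd_hom r r' e) = h;
  dd_id : forall c (g : hom c a) (r : R c g) (e : g ∘ id_hom c = g),
    dd_hom r r e = fid (dd_ob r);
  dd_cmp : forall c c' c'' (g : hom c a) (g' : hom c' a) (g'' : hom c'' a)
    (r : R c g) (r' : R c' g') (r'' : R c'' g'') (h : hom c' c) (h' : hom c'' c')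
    (e : g ∘ h = g') (e' : g' ∘ h' = g'') (e'' : g ∘ (h ∘ h') = g''),
    dd_hom r r' e ∙ dd_hom r' r'' e' = dd_hom r r'' e'' }.

Definition effective (X : cat_over B) (a : B) (R : sieve a)
    (D : descent_datum X R) : Prop :=
  exists (x : X a) (p : forall c (g : hom c a) (r : R c g), fhom (dd_ob D r) x),
    (forall c (g : hom c a) (r : R c g), fproj (p c g r) = g) /\
    (forall c c' (g : hom c a) (g' : hom c' a) (r : R c g) (r' : R c' g')
       (h : hom c' c) (e : g ∘ h = g'),
       p c g r ∙ dd_hom D r r' e = p c' g' r').

Definition morphisms_glue (X : cat_over B) (a : B) (R : sieve a) : Prop :=
  forall (x y : X a)
    (psi : forall c (w : X c) (u : fhom w x), R c (fproj u) -> fhom w y),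
    (forall c (w : X c) (u : fhom w x) (r : R c (fproj u)),
       fproj (psi c w u r) = fproj u) ->
    (forall c c' (w : X c) (w' : X c') (u : fhom w x) (v : fhom w' w)
       (r : R c (fproj u)) (r' : R c' (fproj (u ∙ v))),
       psi c' w' (u ∙ v) r' = psi c w u r ∙ v) ->
    exists! phi : fhom x y, fproj phi = id_hom a /\
      forall c (w : X c) (u : fhom w x) (r : R c (fproj u)), phi ∙ u = psi c w u r.

(* Giraud's form of the stack condition: for a covering sieve R of a, the
   functor X_a -> Hom_B(R, X) is an equivalence.  Stating descent along the sieve
   generated by a covering family, rather than along the family, avoids a choice
   of fibre products and of pull-backs. *)
Definition is_stack
    (J : forall (a : B) (I : Type) (b : I -> B), (forall i, hom (b i) a) -> Prop)
    (X : cat_over B) : Prop :=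
  fibred_in_groupoids X /\
  forall (a : B) (I : Type) (b : I -> B) (f : forall i, hom (b i) a),
    @J a I b f ->
    morphisms_glue X (generated_sieve f) /\
    forall D : descent_datum X (generated_sieve f), effective D.

End Stack.

Section BaseChange.
Variable C : category.

(* A category over C/S1 regarded as a category over C/S via p : S1 -> S. *)
Section Regard.
Variables (S1 S : C) (p : hom S1 S).
Implicit Types X Y : cat_over (slice S1).

#[projections(primitive)]
Record regard_ob (X : cat_over (slice S1)) (a : slice S) := RegardOb {
  rg_str : hom (sdom a) S1;
  rg_strE : p ∘ rg_str = sstr a;
  rg_ob : X (SliceObj rg_str) }.

Lemma regard_proj_subproof X (a b : slice S) (x : regard_ob X a) (y : regard_ob X b)
  (f : fhom (rg_ob x) (rg_ob y)) : sstr b ∘ shom (fproj f) = sstr a.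
Proof. by rewrite -(rg_strE x) -(rg_strE y) -cmpA (shomE (fproj f)). Qed.

Definition regard X : cat_over (slice S).
Proof.
refine (@CatOver (slice S) (regard_ob X) (fun a b x y => fhom (rg_ob x) (rg_ob y))
  (fun a b x y f => @SliceHom C S a b (shom (fproj f)) (regard_proj_subproof f))
  (fun a x => fid (rg_ob x)) (fun a b c x y z g f => g ∙ f) _ _ _ _ _).
- by move=> a x; apply: slice_hom_eq; rewrite /= fproj_id.
- by move=> *; apply: slice_hom_eq; rewrite /= fproj_cmp.
- by move=> *; apply: fcmpA.
- by move=> *; apply: fcmp1m.
- by move=> *; apply: fcmpm1.
Defined.

Definition regard_functor X Y (F : over_functor X Y) :
  over_functor (regard X) (regard Y).
Proof.
refine (@OverFunctor _ (regard X) (regard Y)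
  (fun a x => RegardOb (rg_strE x) (F _ (rg_ob x)))
  (fun a b x y f => fun_hom F f : fhom (F _ (rg_ob x)) (F _ (rg_ob y))) _ _ _).
- by move=> *; apply: slice_hom_eq; rewrite /= fun_proj.
- by move=> *; apply: fun_id.
- by move=> *; apply: fun_cmp.
Defined.

Lemma regard_two_iso_subproof X Y (F G : over_functor X Y) (t : two_iso F G)
    (a : slice S) (x : regard X a) :
  @fproj _ (regard Y) a a (regard_functor F a x) (regard_functor G a x)
    (t _ (rg_ob x)) = id_hom a.
Proof. by apply: slice_hom_eq; rewrite /= tcomp_proj. Qed.

Definition regard_two_iso X Y (F G : over_functor X Y) (t : two_iso F G) :
  two_iso (regard_functor F) (regard_functor G) :=
  @TwoIso _ (regard X) (regard Y) (regard_functor F) (regard_functor G)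
    (fun a x => t _ (rg_ob x)) (regard_two_iso_subproof t)
    (fun a b x y f => tcomp_nat t f) (fun a x => tcomp_inv t (rg_ob x)).

End Regard.

(* The fibre product X x_{S2,s} S1 along s : S1 -> S2, as a category over C/S1
   via the second projection: an object over t : T -> S1 is an object x of X over
   some u : T -> S2 with u = s t; a morphism is a pair of morphisms of X and of
   C/S1 with the same underlying morphism of C. *)
Section Pullback.
Variables (S1 S2 : C) (s : hom S1 S2).
Implicit Types X Y : cat_over (slice S2).

#[projections(primitive)]
Record pullback_ob (X : cat_over (slice S2)) (a : slice S1) := PullbackOb {
  pb_str : hom (sdom a) S2;
  pb_strE : pb_str = s ∘ sstr a;
  pb_ob : X (SliceObj pb_str) }.

Record pullback_hom X (a b : slice S1) (x : pullback_ob X a) (y : pullback_ob X b) :=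
  PullbackHom {
    pb_hom1 : fhom (pb_ob x) (pb_ob y);
    pb_hom2 : hom a b;
    pb_homE : shom (fproj pb_hom1) = shom pb_hom2 }.

Lemma pullback_hom_eq X (a b : slice S1) (x : pullback_ob X a) (y : pullback_ob X b)
  (f g : pullback_hom x y) : pb_hom1 f = pb_hom1 g -> f = g.
Proof.
case: f g => [f f' ef] [g g' eg] /= efg; subst g.
have e : f' = g' by apply: slice_hom_eq; rewrite -ef -eg.
by subst g'; rewrite (Prop_irrelevance ef eg).
Qed.

Lemma pullback_id_subproof X (a : slice S1) (x : pullback_ob X a) :
  shom (fproj (fid (pb_ob x))) = shom (id_hom a).
Proof. by rewrite fproj_id. Qed.

Lemma pullback_cmp_subproof X (a b c : slice S1) (x : pullback_ob X a)
    (y : pullback_ob X b) (z : pullback_ob X c)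
    (g : pullback_hom y z) (f : pullback_hom x y) :
  shom (fproj (pb_hom1 g ∙ pb_hom1 f)) = shom (pb_hom2 g ∘ pb_hom2 f).
Proof. by rewrite fproj_cmp /= !pb_homE. Qed.

Definition pullback X : cat_over (slice S1).
Proof.
refine (@CatOver (slice S1) (pullback_ob X) (@pullback_hom X)
  (fun a b x y f => pb_hom2 f)
  (fun a x => PullbackHom (pullback_id_subproof x))
  (fun a b c x y z g f => PullbackHom (pullback_cmp_subproof g f)) _ _ _ _ _).
- by [].
- by [].
- by move=> *; apply: pullback_hom_eq; apply: fcmpA.
- by move=> *; apply: pullback_hom_eq; apply: fcmp1m.
- by move=> *; apply: pullback_hom_eq; apply: fcmpm1.
Defined.

Lemma pullback_fun_subproof X Y (F : over_functor X Y) (a b : slice S1)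
    (x : pullback_ob X a) (y : pullback_ob X b) (f : pullback_hom x y) :
  shom (fproj (fun_hom F (pb_hom1 f))) = shom (pb_hom2 f).
Proof. by rewrite fun_proj pb_homE. Qed.

Definition pullback_functor X Y (F : over_functor X Y) :
  over_functor (pullback X) (pullback Y).
Proof.
refine (@OverFunctor _ (pullback X) (pullback Y)
  (fun a x => PullbackOb (pb_strE x) (F _ (pb_ob x)))
  (fun a b x y f =>
     @PullbackHom Y a b (PullbackOb (pb_strE x) (F _ (pb_ob x)))
       (PullbackOb (pb_strE y) (F _ (pb_ob y))) _ _ (pullback_fun_subproof F f)) _ _ _).
- by [].
- by move=> *; apply: pullback_hom_eq; apply: fun_id.
- by move=> *; apply: pullback_hom_eq; apply: fun_cmp.
Defined.

Lemma pullback_two_iso_subproof X Y (F G : over_functor X Y) (t : two_iso F G)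
    (a : slice S1) (x : pullback X a) :
  shom (fproj (t _ (pb_ob x))) = shom (id_hom a).
Proof. by rewrite tcomp_proj. Qed.

Definition pullback_two_iso X Y (F G : over_functor X Y) (t : two_iso F G) :
  two_iso (pullback_functor F) (pullback_functor G).
Proof.
refine (@TwoIso _ (pullback X) (pullback Y) (pullback_functor F) (pullback_functor G)
  (fun a x => @PullbackHom Y a a (pullback_functor F a x) (pullback_functor G a x)
                _ _ (pullback_two_iso_subproof t x)) _ _ _).
- by [].
- by move=> a b x y f; apply: pullback_hom_eq; apply: tcomp_nat.
- move=> a x; have [u [ut tu]] := tcomp_inv t (pb_ob x).
  have eu : shom (fproj u) = shom (id_hom a).
    have := congr1 (fun f => fproj f) ut.
    by rewrite fproj_cmp tcomp_proj fproj_id cmpm1 => ->.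
  exists (@PullbackHom Y a a (pullback_functor G a x) (pullback_functor F a x) _ _ eu).
  by split; apply: pullback_hom_eq.
Defined.

(* Identity morphism between objects that differ only in the proof [pb_strE]. *)
Definition pullback_same X (a : slice S1) (u : hom (sdom a) S2)
    (e e' : u = s ∘ sstr a) (x : X (SliceObj u)) :
  @fhom _ (pullback X) a a (PullbackOb e x) (PullbackOb e' x) :=
  @PullbackHom X a a (PullbackOb e x) (PullbackOb e' x) (fid x) (id_hom a)
    (pullback_id_subproof (PullbackOb e x)).

End Pullback.

(* The canonical identification s^*(t^* X) = r^* X for r = t s. *)
Section Canonical.
Variables (S1 S2 S3 : C) (s : hom S1 S2) (t : hom S2 S3) (r : hom S1 S3).
Variables (e : t ∘ s = r) (X : cat_over (slice S3)).

(* These proofs take only the proof components of an object, so that canonical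
   identifications and projections commute with functors definitionally. *)
Lemma pullback_can_subproof (a : slice S1) (v : hom (sdom a) S2) (u : hom (sdom a) S3) :
  v = s ∘ sstr a -> u = t ∘ v -> u = r ∘ sstr a.
Proof. by move=> -> ->; rewrite cmpA e. Qed.

Definition pullback_can_ob (a : slice S1) (x : pullback s (pullback t X) a) :
    pullback r X a :=
  @PullbackOb S1 S3 r X a _
    (pullback_can_subproof (pb_strE x) (pb_strE (pb_ob x))) (pb_ob (pb_ob x)).

Lemma pullback_can_hom_subproof (a b : slice S1) (x : pullback s (pullback t X) a)
    (y : pullback s (pullback t X) b) (f : pullback_hom x y) :
  shom (fproj (pb_hom1 (pb_hom1 f))) = shom (pb_hom2 f).
Proof. by rewrite pb_homE -(pb_homE f). Qed.

Definition pullback_can :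
  over_functor (pullback s (pullback t X)) (pullback r X).
Proof.
refine (@OverFunctor _ (pullback s (pullback t X)) (pullback r X)
  pullback_can_ob
  (fun a b x y f =>
     @PullbackHom S1 S3 r X a b (pullback_can_ob x) (pullback_can_ob y) _ _
       (pullback_can_hom_subproof f)) _ _ _).
- by [].
- by move=> *; apply: pullback_hom_eq.
- by move=> *; apply: pullback_hom_eq.
Defined.

End Canonical.

(* The first projection X x_{S2,s} S1 -> X, when s is a morphism over S. *)
Section Projection.
Variables (S1 S2 S : C) (s : hom S1 S2) (p1 : hom S1 S) (p2 : hom S2 S).
Variables (e : p2 ∘ s = p1) (X : cat_over (slice S2)).

Lemma pullback_fst_subproof (a : slice S) (v : hom (sdom a) S1) (u : hom (sdom a) S2) :
  p1 ∘ v = sstr a -> u = s ∘ v -> p2 ∘ u = sstr a.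
Proof. by move=> <- ->; rewrite cmpA e. Qed.

Definition pullback_fst :
  over_functor (regard p1 (pullback s X)) (regard p2 X).
Proof.
refine (@OverFunctor _ (regard p1 (pullback s X)) (regard p2 X)
  (fun a x => @RegardOb S2 S p2 X a _
     (pullback_fst_subproof (rg_strE x) (pb_strE (rg_ob x))) (pb_ob (rg_ob x)))
  (fun a b x y f => pb_hom1 f) _ _ _).
- by move=> a b x y f; apply: slice_hom_eq; apply: (pb_homE f).
- by [].
- by [].
Defined.

End Projection.

End BaseChange.

Section Action.
Variables (B : category) (Gamma : finGroupType).
Local Open Scope group_scope.

(* Compares 2-morphisms into mu(g) and mu(h) when g = h holds only propositionally,
   as for the two bracketings of a product in [Gamma]. *)
Definition retarget (X Y : cat_over B) (F : Gamma -> over_functor X Y)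
    (G : over_functor X Y) (g h : Gamma) (e : g = h) (t : two_iso G (F g)) :
  two_iso G (F h) :=
  match e in _ = k return two_iso G (F k) with erefl => t end.

Record group_action (Y : cat_over B) := GroupAction {
  mu : Gamma -> over_functor Y Y;
  mu_equiv : forall sigma, is_equivalence (mu sigma);
  alpha : forall tau sigma, two_iso (mu tau ∘F mu sigma) (mu (tau * sigma));
  beta : two_iso (mu 1) (id_functor Y);
  alpha_assoc : forall gamma tau sigma a (y : Y a),
    alpha (gamma * tau) sigma a y ∙ alpha gamma tau a (mu sigma a y) =
    retarget (F := mu) (mulgA gamma tau sigma) (alpha gamma (tau * sigma)) a y
      ∙ fun_hom (mu gamma) (alpha tau sigma a y);
  alpha_unit_r : forall sigma a (y : Y a),
    fun_hom (mu sigma) (beta a y) =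
    retarget (F := mu) (mulg1 sigma) (alpha sigma 1) a y;
  alpha_unit_l : forall sigma a (y : Y a),
    beta a (mu sigma a y) =
    retarget (F := mu) (mul1g sigma) (alpha 1 sigma) a y }.

End Action.

Section Galois.
Variables (C : category) (S' S : C) (p : hom S' S) (Gamma : finGroupType).
Local Open Scope group_scope.

Record left_action := LeftAction {
  lact :> Gamma -> hom S' S';
  lact1 : lact 1 = id_hom S';
  lactM : forall tau sigma, lact (tau * sigma) = lact tau ∘ lact sigma;
  lact_over : forall sigma, p ∘ lact sigma = p }.

(* Gamma x S' is the coproduct P of copies of S' indexed by Gamma, Q is
   S' x_S S', and m is (sigma, x) |-> (sigma x, x). *)
Definition is_galois (A : left_action) : Prop :=
  exists (P Q : C) (inj : Gamma -> hom S' P) (q1 q2 : hom Q S') (m : hom P Q),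
    [/\ is_coproduct inj, is_fibre_product p p q1 q2,
        (forall sigma, q1 ∘ m ∘ inj sigma = A sigma),
        (forall sigma, q2 ∘ m ∘ inj sigma = id_hom S') & is_isom m].

Variables (A : left_action) (X : cat_over (slice S')).

Notation "^ s Y" := (pullback (A s) Y)
  (at level 30, s at level 0, Y at level 30, right associativity).

Lemma lact_along tau sigma rho : tau * sigma = rho -> A tau ∘ A sigma = A rho.
Proof. by move=> <-; rewrite lactM. Qed.

Definition twist_can tau sigma rho (e : tau * sigma = rho) (Y : cat_over (slice S')) :
  over_functor (^ sigma (^ tau Y)) (^ rho Y) :=
  pullback_can (lact_along e) Y.

Section Cocycle.
Variable f : forall sigma, over_functor (^ sigma X) X.
Variable psi : forall tau sigma,
  two_iso (f sigma ∘F pullback_functor (A sigma) (f tau))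
          (f (tau * sigma) ∘F twist_can (erefl (tau * sigma)) X).

(* psi_(tau, sigma) with its target written f_rho, for rho = tau sigma. *)
Definition psi_along tau sigma rho (e : tau * sigma = rho) :
  two_iso (f sigma ∘F pullback_functor (A sigma) (f tau))
          (f rho ∘F twist_can e X) :=
  match e as e' in _ = r return
    two_iso (f sigma ∘F pullback_functor (A sigma) (f tau))
            (f r ∘F twist_can e' X) with
  | erefl => psi tau sigma end.

(* Both composites start at f_sigma (^sigma f_tau (^(tau sigma) f_gamma z)).  They
   end at f_(gamma tau sigma) applied to the two identifications
   ^sigma(^tau(^gamma X)) -> ^(gamma tau sigma) X obtained from the two bracketings,
   which agree up to the proof component, i.e., up to [pullback_same]. *)
Definition two_descent_cocycle : Prop :=
  forall gamma tau sigma a (z : (^ sigma (^ tau (^ gamma X))) a),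
    let w := twist_can (erefl (tau * sigma)) (^ gamma X) a z in
    let w' := pullback_functor (A sigma) (twist_can (erefl (gamma * tau)) X) a z in
    let assoc := pullback_same
      (pb_strE (twist_can (mulgA gamma tau sigma) X a w))
      (pb_strE (twist_can (erefl (gamma * tau * sigma)) X a w'))
      (pb_ob (pb_ob (pb_ob z))) in
    fun_hom (f (gamma * tau * sigma)) assoc
      ∙ (psi_along (mulgA gamma tau sigma) a w
         ∙ psi tau sigma a
             (pullback_functor (A sigma) (pullback_functor (A tau) (f gamma)) a z))
    = psi (gamma * tau) sigma a w'
      ∙ fun_hom (f sigma) (pullback_two_iso (A sigma) (psi gamma tau) a z).

End Cocycle.

Record galois_2descent_datum := GaloisDatum {
  gf : forall sigma, over_functor (^ sigma X) X;
  gf_equiv : forall sigma, is_equivalence (gf sigma);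
  gpsi : forall tau sigma,
    two_iso (gf sigma ∘F pullback_functor (A sigma) (gf tau))
            (gf (tau * sigma) ∘F twist_can (erefl (tau * sigma)) X);
  gpsi_cocycle : two_descent_cocycle gpsi }.

(* A 2-isomorphism between functors to C/S' over C/S is an identity, so the square
   of mu(sigma) and sigma commutes iff the structure morphisms T -> S' agree; on
   morphisms this is automatic, mu(sigma) being a functor over C/S. *)
Definition compatible_action (M : group_action Gamma (regard p X)) : Prop :=
  forall sigma (a : slice S) (x : regard p X a),
    rg_str (mu M sigma a x) = A sigma ∘ rg_str x.

(* The functor ^sigma X -> X over S sending (x, t) to mu(sigma^-1)(x). *)
Definition action_functor (M : group_action Gamma (regard p X)) sigma :
  over_functor (regard p (^ sigma X)) (regard p X) :=
  mu M sigma^-1 ∘F pullback_fst (lact_over A sigma) X.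

(* [theta] identifies, over S, the f_sigma with the [action_functor]s, and the
   psi_(tau, sigma) with the alpha_(sigma^-1, tau^-1). *)
Definition induced_by_action (M : group_action Gamma (regard p X))
    (D : galois_2descent_datum)
    (theta : forall sigma,
       two_iso (regard_functor p (gf D sigma)) (action_functor M sigma)) : Prop :=
  forall tau sigma (a : slice S) (z : regard p (^ sigma (^ tau X)) a),
    let z1 := pullback_fst (lact_over A sigma) (^ tau X) a z in
    let z2 := pullback_fst (lact_over A tau) X a z1 in
    let w := regard_functor p (twist_can (erefl (tau * sigma)) X) a z in
    let w2 := pullback_fst (lact_over A (tau * sigma)) X a w in
    let same : fhom z2 w2 := fid (rg_ob z2) in
    theta (tau * sigma) a w ∙ regard_two_iso p (gpsi D tau sigma) a z
    = fun_hom (mu M (tau * sigma)^-1) same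
      ∙ (retarget (F := mu M) (esym (invMg tau sigma)) (alpha M sigma^-1 tau^-1) a z2
         ∙ (fun_hom (mu M sigma^-1) (theta tau a z1)
            ∙ theta sigma a
                (regard_functor p (pullback_functor (A sigma) (gf D tau)) a z))).

Definition datum_iso (D D' : galois_2descent_datum)
    (chi : forall sigma, two_iso (gf D sigma) (gf D' sigma)) : Prop :=
  forall tau sigma a (z : (^ sigma (^ tau X)) a),
    chi (tau * sigma) a (twist_can (erefl (tau * sigma)) X a z) ∙ gpsi D tau sigma a z
    = gpsi D' tau sigma a z
      ∙ (chi sigma a (pullback_functor (A sigma) (gf D' tau) a z)
         ∙ fun_hom (gf D sigma) (pullback_two_iso (A sigma) (chi tau) a z)).

End Galois.

Section Algebra.
Local Open Scope ring_scope.

Definition ring_hom (A B : pzRingType) (phi : A -> B) : Prop :=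
  zmod_morphism phi /\ GRing.monoid_morphism phi.

Definition prime_ideal (A : comPzRingType) (P : set A) : Prop :=
  [/\ P 0, forall a b, P a -> P b -> P (a + b), forall a b, P b -> P (a * b),
      ~ P 1 & forall a b, P (a * b) -> P a \/ P b].

(* phi exhibits B as A[1/f]. *)
Definition is_localization (A B : comPzRingType) (f : A) (phi : A -> B) : Prop :=
  [/\ exists g, g * phi f = 1,
      forall b, exists a n, phi f ^+ n * b = phi a &
      forall a, phi a = 0 -> exists n, f ^+ n * a = 0].

Definition finite_ring_map (A B : comPzRingType) (phi : A -> B) : Prop :=
  exists (n : nat) (b : 'I_n -> B),
    forall y, exists a : 'I_n -> A, y = \sum_i phi (a i) * b i.

(* A polynomial in n variables over A is given by a list of its terms, as pairs
   of a coefficient and an exponent vector. *)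
Definition eval_terms (A B : comPzRingType) (phi : A -> B) (n : nat) (b : 'I_n -> B)
    (g : seq (A * ('I_n -> nat))) : B :=
  \sum_(t <- g) phi t.1 * \prod_i b i ^+ t.2 i.

(* B = A[x_1, ..., x_n]/(g_1, ..., g_m), by its universal property. *)
Definition finitely_presented (A B : comPzRingType) (phi : A -> B) : Prop :=
  exists (n m : nat) (b : 'I_n -> B) (g : 'I_m -> seq (A * ('I_n -> nat))),
    (forall j, eval_terms phi b (g j) = 0) /\
    forall (D : comPzRingType) (chi : A -> D) (d : 'I_n -> D), ring_hom chi ->
      (forall j, eval_terms chi d (g j) = 0) ->
      exists! theta : B -> D, [/\ ring_hom theta,
        forall a, theta (phi a) = chi a & forall i, theta (b i) = d i].

(* The element \sum n_i (x) b_i of N (x)_A B vanishes, i.e., is killed by every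
   A-bilinear map; B is an A-module via phi. *)
Definition tensor_zero (A B : comPzRingType) (phi : A -> B) (N : lmodType A)
    (s : seq (N * B)) : Prop :=
  forall (P : lmodType A) (beta : N -> B -> P),
    (forall x y b, beta (x + y) b = beta x b + beta y b) ->
    (forall x b c, beta x (b + c) = beta x b + beta x c) ->
    (forall a x b, beta (a *: x) b = a *: beta x b) ->
    (forall a x b, beta x (phi a * b) = a *: beta x b) ->
    \sum_(t <- s) beta t.1 t.2 = 0.

Definition flat_ring_map (A B : comPzRingType) (phi : A -> B) : Prop :=
  forall (N N' : lmodType A) (j : {linear N -> N'}), injective j ->
  forall s : seq (N * B),
    tensor_zero phi [seq (j t.1, t.2) | t <- s] -> tensor_zero phi s.

(* The module of Kaehler differentials of B over A vanishes. *)
Definition no_differentials (A B : comPzRingType) (phi : A -> B) : Prop :=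
  forall (M : lmodType B) (d : B -> M),
    (forall b c, d (b + c) = d b + d c) ->
    (forall b c, d (b * c) = b *: d c + c *: d b) ->
    (forall a, d (phi a) = 0) ->
    forall b, d b = 0.

End Algebra.

Section Schemes.
Local Open Scope ring_scope.
Local Open Scope classical_set_scope.

Record opens (T : topologicalType) := Opens { oset :> set T; opensP : open oset }.

Definition in_opens (T : topologicalType) (U : opens T) (x : T) : Prop := oset U x.

Coercion in_opens : opens >-> Funclass.

Record ringed_space := RingedSpace {
  pts :> topologicalType;
  sec : opens pts -> comPzRingType;
  res : forall U V : opens pts, V `<=` U -> {rmorphism sec U -> sec V};
  res_id : forall (U : opens pts) (h : U `<=` U) (s : sec U), res h s = s;
  res_comp : forall (U V W : opens pts) (h : V `<=` U) (h' : W `<=` V)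
    (h'' : W `<=` U) (s : sec U), res h' (res h s) = res h'' s;
  sec_glue : forall (U : opens pts) (cov : set (opens pts))
    (hU : forall V, cov V -> V `<=` U),
    (forall x : pts, U x -> exists2 V, cov V & V x) ->
    forall s : forall V, cov V -> sec V,
    (forall V V' (c : cov V) (c' : cov V') (W : opens pts) (h : W `<=` V)
       (h' : W `<=` V'), res h (s V c) = res h' (s V' c')) ->
    exists! t : sec U, forall V (c : cov V), res (hU V c) t = s V c }.

Arguments res {r U V} _.

(* The germ of s at x is invertible in the stalk. *)
Definition germ_unit (X : ringed_space) (x : X) (U : opens X) (s : sec U) : Prop :=
  exists (V : opens X) (h : V `<=` U), V x /\ exists t : sec V, t * res h s = 1.

(* Every stalk is a nonzero ring in which s or 1 - s is invertible, for each s. *)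
Definition local_stalks (X : ringed_space) : Prop :=
  forall (x : X) (U : opens X), U x ->
    (1 : sec U) <> 0 /\ forall s : sec U, germ_unit x s \/ germ_unit x (1 - s).

(* (U, O_X|U) is isomorphic to Spec O_X(U): there is a homeomorphism from U to
   the set of prime ideals of O_X(U) with the Zariski topology, under which
   O_X(U) -> O_X(D(f)) is a localization at f for every f. *)
Definition affine_open (X : ringed_space) (U : opens X) : Prop :=
  exists p : X -> set (sec U),
    let D (f : sec U) : set X := [set x | U x /\ ~ p x f] in
    [/\ forall x, U x -> prime_ideal (p x),
        forall x y, U x -> U y -> p x = p y -> x = y,
        forall P, prime_ideal P -> exists2 x, U x & p x = P,
        forall W : set X, W `<=` U ->
          (open W <-> exists E : set (sec U), W = \bigcup_(f in E) D f) &
        forall (f : sec U) (V : opens X) (h : V `<=` U), V = D f :> set X ->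
          is_localization f (res h)].

Record scheme := Scheme {
  space :> ringed_space;
  scheme_local : local_stalks space;
  scheme_affine : forall x : space, exists2 U : opens space, U x & affine_open U }.

(* A morphism of locally ringed spaces.  For U contained in the preimage of V,
   [pull] is the map O_Y(V) -> O_X(f^-1 V) -> O_X(U). *)
Record scheme_hom (X Y : scheme) := SchemeHom {
  pt :> X -> Y;
  pt_cts : continuous pt;
  pull : forall (V : opens Y) (U : opens X), U `<=` pt @^-1` V -> sec V -> sec U;
  pull_ring_hom : forall (V : opens Y) (U : opens X) (h : U `<=` pt @^-1` V),
    ring_hom (pull h);
  pull_res : forall (V V' : opens Y) (U U' : opens X) (h : U `<=` pt @^-1` V)
    (h' : U' `<=` pt @^-1` V') (hV : V' `<=` V) (hU : U' `<=` U) (s : sec V),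
    pull h' (res hV s) = res hU (pull h s);
  pull_local : forall (V : opens Y) (U : opens X) (h : U `<=` pt @^-1` V) (s : sec V)
    (x : X), U x -> germ_unit x (pull h s) -> germ_unit (pt x) s }.

Arguments pull {X Y} f {V U} _ _ : rename.
Arguments pull_ring_hom {X Y} f {V U} _ : rename.
Arguments pull_res {X Y} f {V V' U U'} _ _ _ _ _ : rename.
Arguments pull_local {X Y} f {V U} _ {s x} _ _ : rename.

Lemma scheme_hom_eq (X Y : scheme) (f g : scheme_hom X Y) :
  (forall x, f x = g x) ->
  (forall (V : opens Y) (U : opens X) (h : U `<=` f @^-1` V) (h' : U `<=` g @^-1` V)
     (s : sec V), pull f h s = pull g h' s) ->
  f = g.
Proof.
case: f g => [f cf pf rf nf lf] [g cg pg rg ng lg] /= efg.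
have {}efg : f = g by apply/funext.
subst g => epull.
have e : pf = pg.
  apply: functional_extensionality_dep => V; apply: functional_extensionality_dep => U.
  by apply/funext => h; apply/funext => s; apply: epull.
subst pg; rewrite (Prop_irrelevance cf cg) (Prop_irrelevance rf rg).
by rewrite (Prop_irrelevance nf ng) (Prop_irrelevance lf lg).
Qed.

Definition opens_preimage (X Y : scheme) (f : scheme_hom X Y) (V : opens Y) : opens X :=
  Opens ((continuousP f).1 (@pt_cts X Y f) V (opensP V)).

Definition scheme_id (X : scheme) : scheme_hom X X.
Proof.
refine (@SchemeHom X X id _ (fun V U h s => res h s) _ _ _).
- by move=> x.
- move=> V U h; split; first exact: rmorphB.
  by split; [exact: rmorph1 | exact: rmorphM].
- move=> V V' U U' h h' hV hU s.
  have h'' : U' `<=` V by move=> x /h' /hV.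
  by rewrite (res_comp _ _ h'') (res_comp _ _ h'').
- move=> V U h s x Ux [W [k [Wx [t e]]]].
  have k' : W `<=` V by move=> y /k /h.
  exists W, k'; split=> //; exists t.
  by rewrite -(res_comp h k).
Defined.

Definition scheme_comp (X Y Z : scheme) (g : scheme_hom Y Z) (f : scheme_hom X Y) :
  scheme_hom X Z.
Proof.
refine (@SchemeHom X Z (g \o f) _
  (fun V U h s => pull f (V := opens_preimage g V) h
                    (pull g (U := opens_preimage g V) (@subset_refl _ _) s)) _ _ _).
- by move=> x; apply: continuous_comp; apply: pt_cts.
- move=> V U h.
  set h1 : opens_preimage g V `<=` g @^-1` V := @subset_refl _ _.
  have [fB [f1 fM]] := pull_ring_hom f (V := opens_preimage g V) h.
  have [gB [g1 gM]] := pull_ring_hom g h1.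
  split; first by move=> s t; rewrite gB fB.
  by split; [rewrite g1 f1 | move=> s t; rewrite gM fM].
- move=> V V' U U' h h' hV hU s.
  have hg : opens_preimage g V' `<=` opens_preimage g V by move=> y /hV.
  by rewrite (pull_res g (U := opens_preimage g V) (@subset_refl _ _) _ _ hg)
             (pull_res f (V := opens_preimage g V) h _ _ hU).
- move=> V U h s x Ux.
  move/(pull_local f (V := opens_preimage g V) h Ux).
  exact: (pull_local g (U := opens_preimage g V) (@subset_refl _ _) (h _ Ux)).
Defined.

Definition Sch : category.
Proof.
refine (@Category scheme scheme_hom scheme_id scheme_comp _ _ _).
- move=> X Y Z T h g f; apply: scheme_hom_eq => // V U k k' s /=.
  set W := opens_preimage g (opens_preimage h V).
  set W' := opens_preimage (scheme_comp h g) V.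
  have e : W' `<=` W by [].
  rewrite -(res_id (@subset_refl _ U) (pull f _ _)).
  rewrite -(pull_res f (V := W) (V' := W') k k' e).
  rewrite -(pull_res g (V := opens_preimage h V) (V' := opens_preimage h V)
              _ _ (@subset_refl _ _) e).
  by rewrite res_id (Prop_irrelevance e (@subset_refl _ W')).
- move=> X Y f; apply: scheme_hom_eq => // V U k k' s /=.
  by rewrite (pull_res f (V := V) k' _ _ (@subset_refl _ U)) res_id.
- move=> X Y f; apply: scheme_hom_eq => // V U k k' s /=.
  by rewrite -(pull_res f (V := V) _ k' (@subset_refl _ V)) res_id.
Defined.

Definition surjective_hom (X Y : scheme) (f : scheme_hom X Y) : Prop :=
  forall y, exists x, f x = y.

Definition finite_hom (X Y : scheme) (f : scheme_hom X Y) : Prop :=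
  forall y : Y, exists V : opens Y,
    [/\ V y, affine_open V, affine_open (opens_preimage f V) &
        finite_ring_map (pull f (V := V) (U := opens_preimage f V) (@subset_refl _ _))].

(* x has an affine neighbourhood U mapped by f into an affine open V such that
   Q holds for O_Y(V) -> O_X(U). *)
Definition locally_on_source
    (Q : forall A B : comPzRingType, (A -> B) -> Prop)
    (X Y : scheme) (f : scheme_hom X Y) : Prop :=
  forall x : X, exists (V : opens Y) (U : opens X) (h : U `<=` f @^-1` V),
    [/\ U x, affine_open V, affine_open U & Q _ _ (pull f h)].

Definition locally_finitely_presented := locally_on_source finitely_presented.

(* Flatness of the maps of stalks is flatness of O_Y(V) -> O_X(U) for all affine
   opens U, V with f(U) contained in V. *)
Definition flat_hom (X Y : scheme) (f : scheme_hom X Y) : Prop :=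
  forall (V : opens Y) (U : opens X) (h : U `<=` f @^-1` V),
    affine_open V -> affine_open U -> flat_ring_map (pull f h).

(* Flat, locally of finite presentation and unramified. *)
Definition etale_hom (X Y : scheme) (f : scheme_hom X Y) : Prop :=
  [/\ flat_hom f, locally_finitely_presented f &
      locally_on_source no_differentials f].

Definition fppf_covering (S : Sch) (T : slice S) (I : Type) (T_ : I -> slice S)
    (f : forall i, hom (T_ i) T) : Prop :=
  (forall i, flat_hom (shom (f i)) /\ locally_finitely_presented (shom (f i))) /\
  forall y : sdom T, exists i (x : sdom (T_ i)), (shom (f i) : scheme_hom _ _) x = y.

Definition stack_over (S : Sch) (X : cat_over (slice S)) : Prop :=
  is_stack (@fppf_covering S) X.

End Schemes.

(* Main.v *)
Require Import Defs.
From mathcomp Require Import all_boot all_fingroup boolp.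

(* Regarding categories over C/S' as categories over C/S is fully faithful on
   2-isomorphisms, and every functor over C/S which respects the structure morphisms
   to S' is 2-isomorphic to one defined over C/S'; the latter applies to
   (x, t) |-> mu(sigma^-1)(x) because the squares commute, and gives f_sigma and
   theta_sigma.  As the components of theta are invertible, the equation expressing
   psi_(tau, sigma) through alpha_(sigma^-1, tau^-1) has exactly one solution, and
   after composing with theta the cocycle condition for psi becomes the associativity
   of alpha.  In the same way theta'_sigma o chi_sigma = theta_sigma has exactly one
   solution, and these solutions are compatible with the psi's. *)

Set Implicit Arguments.
Unset Strict Implicit.
Unset Printing Implicit Defensive.

Local Open Scope cat_scope.

(** * Invertible morphisms and 2-isomorphisms over a fixed base *)

Section Isomorphisms.
Variable B : category.

(** This has the form of [tcomp_inv], so [tcomp_inv t x] is itself a proof that the component of [t]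
    at [x] is invertible. *)
Definition fiso (X : cat_over B) (a b : B) (x : X a) (y : X b) (f : fhom x y) : Prop :=
  exists t : fhom y x, t ∙ f = fid x /\ f ∙ t = fid y.

Lemma fiso_id (X : cat_over B) (a : B) (x : X a) : fiso (fid x).
Proof. by exists (fid x); rewrite fcmp1m. Qed.

Lemma fiso_cmp (X : cat_over B) (a b c : B) (x : X a) (y : X b) (z : X c)
  (g : fhom y z) (f : fhom x y) : fiso g -> fiso f -> fiso (g ∙ f).
Proof.
move=> [g' [g'g gg']] [f' [f'f ff']]; exists (f' ∙ g'); split.
  by rewrite -fcmpA (fcmpA g') g'g fcmp1m.
by rewrite -fcmpA (fcmpA f) ff' fcmp1m.
Qed.

Lemma fiso_fun (X Y : cat_over B) (F : over_functor X Y) (a b : B) (x : X a) (y : X b)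
  (f : fhom x y) : fiso f -> fiso (fun_hom F f).
Proof. by move=> [t [tf ft]]; exists (fun_hom F t); rewrite -!fun_cmp tf ft !fun_id. Qed.

Lemma fiso_monic (X : cat_over B) (a b c : B) (x : X a) (y : X b) (z : X c)
  (f : fhom y z) (g h : fhom x y) : fiso f -> f ∙ g = f ∙ h -> g = h.
Proof.
by move=> [t [tf _]] /(congr1 (fun k => t ∙ k)); rewrite !fcmpA tf !fcmp1m.
Qed.

(** The solution is returned as data, obtained by choice from the mere existence of an inverse,
    because components of 2-isomorphisms are data. *)
Lemma fiso_solve (X : cat_over B) (a b c : B) (x : X a) (y : X b) (z : X c)
  (f : fhom y z) (g : fhom x z) : fiso f -> fiso g -> {h : fhom x y | f ∙ h = g /\ fiso h}.
Proof.
move=> f_iso g_iso; apply: cid; have [t [tf ft]] := f_iso.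
exists (t ∙ g); split; first by rewrite fcmpA ft fcmp1m.
by apply: fiso_cmp => //; exists f.
Qed.

Lemma two_iso_id (X Y : cat_over B) (F : over_functor X Y) : two_iso F F.
Proof.
refine (@TwoIso B X Y F F (fun a x => fid (F a x)) _ _ _).
- by move=> *; apply: fproj_id.
- by move=> *; rewrite fcmp1m fcmpm1.
- by move=> *; apply: fiso_id.
Defined.

(** Composites bracketed differently have the same maps on objects and morphisms; only the proofs of
    the functor laws differ, and proof irrelevance identifies these. *)
Lemma two_iso_same (X Y : cat_over B) ob hm p q r p' q' r' :
  two_iso (@OverFunctor B X Y ob hm p q r) (@OverFunctor B X Y ob hm p' q' r').
Proof.
rewrite (Prop_irrelevance p p') (Prop_irrelevance q q') (Prop_irrelevance r r').
exact: two_iso_id.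
Defined.

Lemma two_iso_trans (X Y : cat_over B) (F G H : over_functor X Y) :
  two_iso G H -> two_iso F G -> two_iso F H.
Proof.
move=> t s; refine (@TwoIso B X Y F H (fun a x => t a x ∙ s a x) _ _ _).
- by move=> a x; rewrite fproj_cmp !tcomp_proj cmp1m.
- by move=> a b x y f; rewrite -fcmpA tcomp_nat fcmpA tcomp_nat -fcmpA.
- by move=> a x; apply: fiso_cmp; apply: tcomp_inv.
Qed.

(** The equation is solved object by object; naturality of the solution follows from that of [r] and
    [t], since components of [r] cancel on the left. *)
Lemma two_iso_factor (X Y : cat_over B) (F G H : over_functor X Y)
  (r : two_iso G H) (t : two_iso F H) :
  {u : two_iso F G | forall a (x : X a), r a x ∙ u a x = t a x}.
Proof.
pose c a (x : X a) := fiso_solve (tcomp_inv r x) (tcomp_inv t x).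
pose u a (x : X a) := sval (c a x).
have ru a (x : X a) : r a x ∙ u a x = t a x by case: (svalP (c a x)).
have u_proj a (x : X a) : fproj (u a x) = id_hom a.
  have := congr1 (@fproj _ _ _ _ _ _) (ru a x).
  by rewrite fproj_cmp !tcomp_proj cmp1m.
have u_nat a b (x : X a) (y : X b) (f : fhom x y) :
    u b y ∙ fun_hom F f = fun_hom G f ∙ u a x.
  apply: (fiso_monic (tcomp_inv r y)).
  by rewrite !fcmpA ru !tcomp_nat -fcmpA ru.
have u_iso a (x : X a) : fiso (u a x) by case: (svalP (c a x)).
by exists (@TwoIso B X Y F G u u_proj u_nat u_iso).
Qed.

Lemma two_iso_whiskerl (X Y Z : cat_over B) (K : over_functor Y Z)
  (F G : over_functor X Y) : two_iso F G -> two_iso (K ∘F F) (K ∘F G).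
Proof.
move=> t; refine (@TwoIso B X Z _ _ (fun a x => fun_hom K (t a x)
  : fhom ((K ∘F F) a x) ((K ∘F G) a x)) _ _ _).
- by move=> a x; apply: etrans (fun_proj K _) (tcomp_proj t x).
- by move=> a b x y f /=; rewrite -!fun_cmp tcomp_nat.
- by move=> a x; exact: (fiso_fun K (tcomp_inv t x)).
Qed.

Lemma two_iso_whiskerr (X Y Z : cat_over B) (F G : over_functor Y Z)
  (K : over_functor X Y) : two_iso F G -> two_iso (F ∘F K) (G ∘F K).
Proof.
move=> t; refine (@TwoIso B X Z _ _ (fun a x => t a (K a x)
  : fhom ((F ∘F K) a x) ((G ∘F K) a x)) _ _ _).
- by move=> a x; exact: (tcomp_proj t (K a x)).
- by move=> a b x y f /=; exact: (tcomp_nat t (fun_hom K f)).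
- by move=> a x; exact: (tcomp_inv t (K a x)).
Qed.

Lemma is_equivalence_two_iso (X Y : cat_over B) (F G : over_functor X Y) :
  two_iso F G -> is_equivalence G -> is_equivalence F.
Proof.
move=> t [K [[KG] [GK]]]; exists K; split; constructor.
  exact: two_iso_trans KG (two_iso_whiskerl K t).
exact: two_iso_trans GK (two_iso_whiskerr K t).
Qed.

Lemma is_equivalence_comp (X Y Z : cat_over B) (G : over_functor Y Z)
  (F : over_functor X Y) :
  is_equivalence G -> is_equivalence F -> is_equivalence (G ∘F F).
Proof.
move=> [G' [[G'G] [GG']]] [F' [[F'F] [FF']]]; exists (F' ∘F G'); split; constructor.
  apply: two_iso_trans F'F _.
  apply: (two_iso_trans (G := F' ∘F (G' ∘F G ∘F F))); last exact: two_iso_same.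
  apply: two_iso_whiskerl; apply: (two_iso_trans (G := id_functor Y ∘F F)).
    (* Functors have no definitional eta: destructing [F] is what makes the two sides share their
       maps. *)
    by case: (F) => *; exact: two_iso_same.
  exact: two_iso_whiskerr.
apply: two_iso_trans GG' _.
apply: (two_iso_trans (G := G ∘F (F ∘F F' ∘F G'))); last exact: two_iso_same.
apply: two_iso_whiskerl; apply: (two_iso_trans (G := id_functor Y ∘F G')).
  by case: (G') => *; exact: two_iso_same.
exact: two_iso_whiskerr.
Qed.

End Isomorphisms.

(** * Transport of objects along equalities of structure morphisms *)

Section Cast.
Variables (C : category) (S1 : C) (X : cat_over (slice S1)).

Definition under (a b : slice S1) (x : X a) (y : X b) (f : fhom x y) :
  hom (sdom a) (sdom b) := shom (fproj f).

Definition slice_cast (T : C) (u v : hom T S1) (e : u = v) (x : X (SliceObj u)) :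
    X (SliceObj v) :=
  match e in _ = w return X (SliceObj w) with erefl => x end.

(** Once the equality is eliminated this is an identity. Later arguments handle the transported
    object only through this isomorphism. *)
Lemma slice_cast_hom (T : C) (u v : hom T S1) (e : u = v) (x : X (SliceObj u)) :
  {h : fhom (slice_cast e x) x | fiso h /\ shom (fproj h) = id_hom T}.
Proof.
case: v / e; exists (fid x); split; first exact: fiso_id.
by rewrite fproj_id.
Qed.

End Cast.

(** * Passage from functors and 2-isomorphisms over [S] back to ones over [S1] *)

Section Unregard.
Variables (C : category) (S1 S : C) (p : hom S1 S).
Implicit Types X Y Z : cat_over (slice S1).

Definition to_regard X (a : slice S1) (x : X a) : regard p X (SliceObj (p ∘ sstr a)) :=
  @RegardOb C S1 S p X (SliceObj (p ∘ sstr a)) (sstr a) (erefl _) x.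

Definition to_regard_hom X (a b : slice S1) (x : X a) (y : X b) (f : fhom x y) :
  fhom (to_regard x) (to_regard y) := f.

(* By eta for the primitive record [regard_ob], matching on [rg_strE x] reduces to
   objects of the form [to_regard _], on which [regard_elim] computes. *)
Definition regard_elim X (P : forall a, regard p X a -> Type)
  (h : forall a (x : X a), P _ (to_regard x)) a (x : regard p X a) : P a x :=
  match rg_strE x as e in _ = v
    return P (SliceObj v) (@RegardOb C S1 S p X (SliceObj v) (rg_str x) e (rg_ob x))
  with erefl => h (SliceObj (rg_str x)) (rg_ob x) end.

Lemma shom_fid X (a : slice S1) (x : X a) : shom (fproj (fid x)) = id_hom (sdom a).
Proof. by rewrite fproj_id. Qed.

Lemma fproj_vertical X (T : C) (u v : hom T S1) (x : X (SliceObj u))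
  (y : X (SliceObj v)) (f : fhom x y) : shom (fproj f) = id_hom T -> u = v.
Proof. by move=> f_id; have := shomE (fproj f); rewrite /= f_id cmpm1. Qed.

(** A component has an identity as underlying morphism, yet as a morphism of [Z] it also commutes
    with the structure morphisms to [S1], so these agree. *)
Lemma two_iso_regard_str Y Z (F G : over_functor (regard p Y) (regard p Z))
  (t : two_iso F G) a (y : regard p Y a) : rg_str (F a y) = rg_str (G a y).
Proof.
apply: (@fproj_vertical Z _ _ _ (rg_ob (F a y)) (rg_ob (G a y)) (t a y)).
exact: (congr1 (@shom _ _ _ _) (tcomp_proj t y)).
Qed.

(** The structure morphism of a value of [H] is only propositionally the required one. Transport
    corrects this, and the isomorphisms [c] back to the values of [H] form the 2-isomorphism. *)
Lemma functor_of_regard Y Z (H : over_functor (regard p Y) (regard p Z)) :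
  (forall a (y : regard p Y a), rg_str (H a y) = rg_str y) ->
  {F : over_functor Y Z & two_iso (regard_functor p F) H}.
Proof.
move=> H_str.
pose ob a (y : Y a) : Z a :=
  slice_cast (H_str _ (to_regard y)) (rg_ob (H _ (to_regard y))).
have ob_hom a (y : Y a) := slice_cast_hom (H_str _ (to_regard y))
  (rg_ob (H _ (to_regard y))).
pose c a (y : Y a) : fhom (ob a y) (rg_ob (H _ (to_regard y))) := sval (ob_hom a y).
have c_iso a (y : Y a) : fiso (c a y) by case: (svalP (ob_hom a y)).
have c_proj a (y : Y a) : shom (fproj (c a y)) = id_hom (sdom a).
  by case: (svalP (ob_hom a y)).
(* On morphisms the functor is [H] conjugated by [c]. *)
have lift a b (y : Y a) (z : Y b) (f : fhom y z) :
    {g : fhom (ob a y) (ob b z)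
    | c b z ∙ g = (fun_hom H (to_regard_hom f) : @fhom _ Z _ _ _ _) ∙ c a y}.
  apply: cid; have [t [tc ct]] := c_iso b z.
  exists (t ∙ ((fun_hom H (to_regard_hom f) : @fhom _ Z _ _ _ _) ∙ c a y)).
  by rewrite fcmpA ct fcmp1m.
pose hm a b (y : Y a) (z : Y b) (f : fhom y z) := sval (lift a b y z f).
have hmE a b y z f := svalP (lift a b y z f).
have hm_proj a b (y : Y a) (z : Y b) (f : fhom y z) : fproj (hm a b y z f) = fproj f.
  apply: slice_hom_eq; have := congr1 (@under _ _ _ _ _ _ _) (hmE a b y z f).
  rewrite /under /hm !fproj_cmp /= !c_proj cmp1m cmpm1 => ->.
  exact: (congr1 (@shom _ _ _ _) (fun_proj H (to_regard_hom f))).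
have hm_id a (y : Y a) : hm a a y y (fid y) = fid (ob a y).
  apply: (fiso_monic (c_iso a y)); rewrite hmE fcmpm1.
  by rewrite (fun_id H (to_regard y)) fcmp1m.
have hm_cmp a b d (x : Y a) (y : Y b) (z : Y d) (g : fhom y z) (f : fhom x y) :
    hm a d x z (g ∙ f) = hm b d y z g ∙ hm a b x y f.
  apply: (fiso_monic (c_iso d z)); rewrite fcmpA !hmE -fcmpA hmE fcmpA.
  congr (_ ∙ _); exact: (fun_cmp H (to_regard_hom g) (to_regard_hom f)).
pose F := OverFunctor hm_proj hm_id hm_cmp.
exists F.
(* So far [c] is defined only at objects [to_regard y]; this extends it to all objects of
   [regard p Y]. *)
pose th := regard_elim
  (P := fun a y => fhom (rg_ob (regard_functor p F a y)) (rg_ob (H a y))) c.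
refine (@TwoIso _ _ _ (regard_functor p F) H th _ _ _).
- apply: regard_elim => a y; apply: slice_hom_eq; exact: c_proj.
- move=> a b y z f.
  move: a y f; apply: regard_elim => a y; move: b z; apply: regard_elim => b z f.
  exact: hmE.
- by apply: regard_elim => a y; apply: c_iso.
Qed.

(** Left transparent: [regard_two_iso] of the result, evaluated at [to_regard y], must compute to
    the component of [t] there. *)
Lemma two_iso_of_regard Y Z (F G : over_functor Y Z) :
  two_iso (regard_functor p F) (regard_functor p G) -> two_iso F G.
Proof.
move=> t; refine (@TwoIso _ Y Z F G (fun a y => t _ (to_regard y)) _ _ _).
- move=> a y; apply: slice_hom_eq.
  exact: (congr1 (@shom _ _ _ _) (tcomp_proj t (to_regard y))).
- by move=> a b y z f; apply: (tcomp_nat t (to_regard_hom f)).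
- by move=> a y; apply: (tcomp_inv t (to_regard y)).
Defined.

Lemma two_iso_of_regard_factor Y Z (F G : over_functor Y Z)
  (H : over_functor (regard p Y) (regard p Z))
  (r : two_iso (regard_functor p G) H) (t : two_iso (regard_functor p F) H) :
  {u : two_iso F G | forall a (y : regard p Y a), r a y ∙ regard_two_iso p u a y = t a y}.
Proof.
have [u ru] := two_iso_factor r t; exists (two_iso_of_regard u).
by apply: regard_elim => a y; apply: ru.
Qed.

(** As [F] preserves structure morphisms and [F] after [K] is 2-isomorphic to the identity, the
    quasi-inverse [K] preserves them too. Hence [K] comes from a functor over [S1], and both
    2-isomorphisms come along. *)
Lemma is_equivalence_of_regard Y Z (F : over_functor Y Z) :
  is_equivalence (regard_functor p F) -> is_equivalence F.
Proof.
move=> [K [[KF] [FK]]].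
have [G th] : {G : over_functor Z Y & two_iso (regard_functor p G) K}.
  by apply: functor_of_regard => a z; apply: (two_iso_regard_str FK z).
exists G; split; constructor; apply: two_iso_of_regard.
  apply: (two_iso_trans (G := regard_functor p G ∘F regard_functor p F)).
    apply: (two_iso_trans (G := id_functor (regard p Y))); first exact: two_iso_same.
    exact: two_iso_trans KF (two_iso_whiskerr (regard_functor p F) th).
  exact: two_iso_same.
apply: (two_iso_trans (G := regard_functor p F ∘F regard_functor p G)).
  apply: (two_iso_trans (G := id_functor (regard p Z))); first exact: two_iso_same.
  exact: two_iso_trans FK (two_iso_whiskerl (regard_functor p F) th).
exact: two_iso_same.
Qed.

End Unregard.

(** * The first projection of a pull-back along an isomorphism *)

Section ProjectionEquivalence.
Variables (C : category) (S1 S2 S : C) (s : hom S1 S2) (s' : hom S2 S1).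
Variables (p1 : hom S1 S) (p2 : hom S2 S) (e : p2 ∘ s = p1).
Variables (ss' : s ∘ s' = id_hom S2) (s's : s' ∘ s = id_hom S1).
Variable X : cat_over (slice S2).

Lemma pullback_fst_inv_strE (a : slice S) (x : regard p2 X a) :
  p1 ∘ (s' ∘ rg_str x) = sstr a.
Proof. by rewrite -e -cmpA (cmpA s) ss' cmp1m rg_strE. Qed.

Lemma pullback_fst_inv_pb_strE (a : slice S) (x : regard p2 X a) :
  rg_str x = s ∘ (s' ∘ rg_str x).
Proof. by rewrite cmpA ss' cmp1m. Qed.

(** An object over [u] is paired with [s' ∘ u], the only morphism that [s] carries to [u]. *)
Definition pullback_fst_inv_ob (a : slice S) (x : regard p2 X a) :
    regard p1 (pullback s X) a :=
  @RegardOb C S1 S p1 (pullback s X) a _ (pullback_fst_inv_strE x)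
    (@PullbackOb C S1 S2 s X (SliceObj (s' ∘ rg_str x)) _
       (pullback_fst_inv_pb_strE x) (rg_ob x)).

Lemma pullback_fst_inv_homE (a b : slice S) (x : regard p2 X a) (y : regard p2 X b)
  (f : fhom (rg_ob x) (rg_ob y)) : s' ∘ rg_str y ∘ shom (fproj f) = s' ∘ rg_str x.
Proof. by rewrite -cmpA (shomE (fproj f)). Qed.

Definition pullback_fst_inv : over_functor (regard p2 X) (regard p1 (pullback s X)).
Proof.
refine (@OverFunctor _ (regard p2 X) (regard p1 (pullback s X)) pullback_fst_inv_ob
  (fun a b x y f => @PullbackHom C S1 S2 s X (SliceObj (s' ∘ rg_str x))
     (SliceObj (s' ∘ rg_str y)) (rg_ob (pullback_fst_inv_ob x))
     (rg_ob (pullback_fst_inv_ob y)) f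
     (@SliceHom C S1 (SliceObj (s' ∘ rg_str x)) (SliceObj (s' ∘ rg_str y))
        _ (pullback_fst_inv_homE f)) (erefl _)) _ _ _).
- by move=> a b x y f; apply: slice_hom_eq.
- by move=> a x; apply: pullback_hom_eq.
- by move=> a b c x y z g f; apply: pullback_hom_eq.
Defined.

Lemma pullback_fst_unit_homE (a : slice S) (x : regard p1 (pullback s X) a) :
  rg_str x ∘ id_hom (sdom a) = s' ∘ pb_str (rg_ob x).
Proof. by rewrite cmpm1 (pb_strE (rg_ob x)) cmpA s's cmp1m. Qed.

Lemma pullback_fst_counit_homE (a : slice S) (x : regard p1 (pullback s X) a) :
  s' ∘ pb_str (rg_ob x) ∘ id_hom (sdom a) = rg_str x.
Proof. by rewrite -(pullback_fst_unit_homE x) !cmpm1. Qed.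

Lemma is_equivalence_pullback_fst : is_equivalence (pullback_fst e X).
Proof.
exists pullback_fst_inv; split; constructor; last first.
  (* This composite changes only proof components, so identities of [X] serve as components. *)
  refine (@TwoIso _ (regard p2 X) (regard p2 X) (pullback_fst e X ∘F pullback_fst_inv)
    (id_functor _) (fun a x => fid (rg_ob x)) _ _ _).
  - by move=> a x; apply: slice_hom_eq; rewrite /= fproj_id.
  - by move=> a b x y f; rewrite /= fcmp1m fcmpm1.
  - by move=> a x; apply: (fiso_id (rg_ob x)).
pose FK := pullback_fst_inv ∘F pullback_fst e X.
(* Here a structure morphism [t] turns into [s' ∘ (s ∘ t)], equal to [t] only propositionally. The
   component is therefore an identity of [X] paired with a slice morphism whose underlying morphism
   is an identity. *)
pose to a (x : regard p1 (pullback s X) a) :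
    @fhom _ (pullback s X) _ _ (rg_ob (FK a x)) (rg_ob x) :=
  @PullbackHom C S1 S2 s X _ _ (rg_ob (FK a x)) (rg_ob x) (fid (pb_ob (rg_ob x)))
    (@SliceHom C S1 (SliceObj (s' ∘ pb_str (rg_ob x))) (SliceObj (rg_str x))
      _ (pullback_fst_unit_homE x)) (shom_fid (pb_ob (rg_ob x))).
pose from a (x : regard p1 (pullback s X) a) :
    @fhom _ (pullback s X) _ _ (rg_ob x) (rg_ob (FK a x)) :=
  @PullbackHom C S1 S2 s X _ _ (rg_ob x) (rg_ob (FK a x)) (fid (pb_ob (rg_ob x)))
    (@SliceHom C S1 (SliceObj (rg_str x)) (SliceObj (s' ∘ pb_str (rg_ob x)))
      _ (pullback_fst_counit_homE x)) (shom_fid (pb_ob (rg_ob x))).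
refine (@TwoIso _ (regard p1 (pullback s X)) _ FK (id_functor _) to _ _ _).
- by move=> a x; apply: slice_hom_eq.
- by move=> a b x y f; apply: pullback_hom_eq; rewrite /= fcmp1m fcmpm1.
- by move=> a x; exists (from a x); split; apply: pullback_hom_eq; rewrite /= fcmp1m.
Qed.

End ProjectionEquivalence.

(** * Diagram chases in a category over a base *)

Section Pasting.
Variables (B : category) (Y : cat_over B) (b : B).

(** Bracketed so that splitting off the leftmost square leaves a goal of the same shape for the rest
    of a right-nested composite. *)
Lemma square_paste a0 a1 a2 a0' a1' a2'
  (x : Y a0) (y : Y a1) (z : Y a2) (x' : Y a0') (y' : Y a1') (z' : Y a2')
  (t : fhom x y) (t' : fhom x' y') (k : fhom y z) (k' : fhom y' z')
  (f : fhom x x') (g : fhom y y') (h : fhom z z') :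
  k' ∙ g = h ∙ k -> t' ∙ f = g ∙ t -> k' ∙ t' ∙ f = h ∙ (k ∙ t).
Proof. by move=> ek et; rewrite -fcmpA et fcmpA ek -fcmpA. Qed.

(* [paste_left] and [paste_right] are the two sides of the cocycle condition after
   composition with theta = [t]: in the former [a] is the identification of the two
   bracketings and [p], [q] are the psi's, in the latter they are [p] and [f]. *)
Lemma paste_left (x0 x1 x2 x3 x4 y2 v1 v2 v3 m1 m2 m3 n2 n3 o3 : Y b)
  (t : fhom x3 x4) (a : fhom x2 x3) (p : fhom x1 x2) (q : fhom x0 x1)
  (t' : fhom x2 y2) (a' : fhom y2 x4)
  (v : fhom x1 v1) (u : fhom v1 v2) (l1 : fhom v2 v3) (s1 : fhom v3 y2)
  (m : fhom x0 m1) (k : fhom m1 m2) (l2 : fhom m2 m3) (s2 : fhom m3 v1)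
  (u' : fhom m3 n3) (s2' : fhom n3 v2) (u'' : fhom m2 n2) (l2' : fhom n2 n3)
  (l1' : fhom n3 o3) (s2'' : fhom o3 v3) :
  t ∙ a = a' ∙ t' -> t' ∙ p = s1 ∙ (l1 ∙ (u ∙ v)) -> v ∙ q = s2 ∙ (l2 ∙ (k ∙ m)) ->
  u ∙ s2 = s2' ∙ u' -> u' ∙ l2 = l2' ∙ u'' -> l1 ∙ s2' = s2'' ∙ l1' ->
  t ∙ (a ∙ (p ∙ q)) = a' ∙ (s1 ∙ s2'') ∙ (l1' ∙ l2' ∙ (u'' ∙ (k ∙ m))).
Proof.
move=> ta tp vq us ul ls.
rewrite fcmpA ta -!fcmpA (fcmpA t') tp -!fcmpA vq (fcmpA u) us -!fcmpA (fcmpA u') ul.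
by rewrite -!fcmpA (fcmpA l1) ls -!fcmpA.
Qed.

Lemma paste_right (x0 x1 x2 x3 v1 v2 v3 m1 m2 m3 m4 n3 : Y b)
  (t : fhom x2 x3) (p : fhom x1 x2) (f : fhom x0 x1)
  (m : fhom x1 v1) (k : fhom v1 v2) (l : fhom v2 v3) (s : fhom v3 x3)
  (m' : fhom x0 m1) (f' : fhom m1 v1) (u1 : fhom m1 m4) (u : fhom m4 m2)
  (l' : fhom m2 m3) (s' : fhom m3 v2) (l'' : fhom m3 n3) (s'' : fhom n3 v3) :
  t ∙ p = s ∙ (l ∙ (k ∙ m)) -> m ∙ f = f' ∙ m' -> k ∙ f' = s' ∙ (l' ∙ (u ∙ u1)) ->
  l ∙ s' = s'' ∙ l'' ->
  t ∙ (p ∙ f) = s ∙ s'' ∙ (l'' ∙ l' ∙ (u ∙ (u1 ∙ m'))).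
Proof.
move=> tp mf kf ls.
by rewrite fcmpA tp -!fcmpA mf (fcmpA k) kf -!fcmpA (fcmpA l) ls -!fcmpA.
Qed.

Lemma paste_congr (x y z t : Y b) (h h' : fhom z t) (g g' : fhom y z) (f : fhom x y) :
  h = h' -> g = g' -> h ∙ (g ∙ f) = h' ∙ (g' ∙ f).
Proof. by move=> -> ->. Qed.

(** The compatibility of chi with the psi's after composition with theta' = [t]: [d], [c], [q] come
    from chi, [p] and [p'] are the two psi's, and [l] is alpha. *)
Lemma paste_comparison (x0 x1 x2 x3 x4 y1 v1 v2 v3 v4 : Y b)
  (t : fhom x3 x4) (d : fhom x2 x3) (t0 : fhom x2 x4) (p : fhom x0 x2)
  (p' : fhom y1 x3) (c : fhom x1 y1) (q : fhom x0 x1)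
  (s : fhom v4 x4) (l : fhom v3 v4) (k : fhom v1 v3) (m : fhom x0 v1)
  (k' : fhom v2 v3) (m' : fhom y1 v2) (m'' : fhom x1 v2) (q' : fhom v1 v2) :
  t ∙ d = t0 -> t0 ∙ p = s ∙ (l ∙ (k ∙ m)) -> t ∙ p' = s ∙ (l ∙ (k' ∙ m')) ->
  m' ∙ c = m'' -> m'' ∙ q = q' ∙ m -> k' ∙ q' = k ->
  t ∙ (d ∙ p) = t ∙ (p' ∙ (c ∙ q)).
Proof.
move=> td tp tp' mc mq kq.
by rewrite fcmpA td tp [RHS]fcmpA tp' -!fcmpA (fcmpA m') mc mq (fcmpA k') kq.
Qed.

End Pasting.

(** * The functors attached to an action, and identifications of iterated pull-backs *)

Section Descent.
Variables (C : category) (S' S : C) (p : hom S' S) (Gamma : finGroupType).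
Local Open Scope group_scope.
Variables (A : left_action p Gamma) (X : cat_over (slice S')).
Variables (M : group_action Gamma (regard p X)) (M_square : compatible_action A M).

(** The commuting square for [sigma^-1] cancels the [sigma] that the pull-back puts into the
    structure morphism. *)
Lemma action_functor_str sigma a (x : regard p (pullback (A sigma) X) a) :
  rg_str (action_functor A M sigma a x) = rg_str x.
Proof.
rewrite M_square /= (pb_strE (rg_ob x)) /= cmpA -lactM mulVg lact1; exact: cmp1m.
Qed.

Lemma is_equivalence_action_functor sigma : is_equivalence (action_functor A M sigma).
Proof.
apply: is_equivalence_comp; first exact: mu_equiv.
apply: (@is_equivalence_pullback_fst _ _ _ _ _ (A sigma^-1)).
  by rewrite -lactM mulgV lact1.
by rewrite -lactM mulVg lact1.
Qed.

(** Products are replaced by arbitrary names because the inverse of a product is the reversed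
    product of inverses only propositionally. *)
Lemma alpha_assoc_along g h k m n r (e1 : m * k = r) (e2 : g * h = m) (e3 : g * n = r)
    (e4 : h * k = n) a (y : regard p X a) :
  retarget (F := mu M) e1 (alpha M m k) a y
    ∙ retarget (F := mu M) e2 (alpha M g h) a (mu M k a y) =
  retarget (F := mu M) e3 (alpha M g n) a y
    ∙ fun_hom (mu M g) (retarget (F := mu M) e4 (alpha M h k) a y).
Proof.
subst m n r; rewrite (Prop_irrelevance e3 (mulgA g h k)); exact: alpha_assoc.
Qed.

Notation fst sigma Y := (pullback_fst (lact_over A sigma) Y).
Notation "^ s Y" := (pullback (A s) Y)
  (at level 30, s at level 0, Y at level 30, right associativity).

(* An identity: the two objects differ only in the proof [rg_strE]. *)
Definition fst_twist (Y : cat_over (slice S')) tau sigma rho (e : tau * sigma = rho) a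
    (z : regard p (^ sigma (^ tau Y)) a) :
  fhom (fst tau Y a (fst sigma (^ tau Y) a z))
       (fst rho Y a (regard_functor p (twist_can A e Y) a z)) :=
  fid (pb_ob (pb_ob (rg_ob z))).

Lemma fst_twist_iso (Y : cat_over (slice S')) tau sigma rho (e : tau * sigma = rho) a
  (z : regard p (^ sigma (^ tau Y)) a) : fiso (fst_twist e z).
Proof. exact: (fiso_id (pb_ob (pb_ob (rg_ob z)))). Qed.

Lemma fst_twist_nat (Y : cat_over (slice S')) tau sigma rho (e : tau * sigma = rho) a b
    (z : regard p (^ sigma (^ tau Y)) a) (y : regard p (^ sigma (^ tau Y)) b)
    (g : fhom z y) :
  fst_twist e y ∙ fun_hom (fst tau Y) (fun_hom (fst sigma (^ tau Y)) g) =
  fun_hom (fst rho Y) (fun_hom (regard_functor p (twist_can A e Y)) g) ∙ fst_twist e z.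
Proof. by rewrite /= fcmp1m fcmpm1. Qed.

(** * The 2-isomorphisms psi and their cocycle condition *)

Section Cocycle.
Variable f : forall sigma, over_functor (pullback (A sigma) X) X.
Variable theta : forall sigma,
  two_iso (regard_functor p (f sigma)) (action_functor A M sigma).

(** The right-hand side of [induced_by_action], with [rho] and both group equations as parameters so
    that it also covers the other bracketing of a triple product. *)
Definition induced_target tau sigma rho (e : tau * sigma = rho)
    (e' : sigma^-1 * tau^-1 = rho^-1) (a : slice S)
    (z : regard p (^ sigma (^ tau X)) a) :
    fhom (regard_functor p (f sigma ∘F pullback_functor (A sigma) (f tau)) a z)
      (action_functor A M rho a (regard_functor p (twist_can A e X) a z)) :=
  let z1 := fst sigma (^ tau X) a z in
  fun_hom (mu M rho^-1) (fst_twist e z)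
    ∙ (retarget (F := mu M) e' (alpha M sigma^-1 tau^-1) a (fst tau X a z1)
       ∙ (fun_hom (mu M sigma^-1) (theta tau a z1)
          ∙ theta sigma a
              (regard_functor p (pullback_functor (A sigma) (f tau)) a z))).

Lemma induced_target_iso tau sigma rho (e : tau * sigma = rho) e' a
  (z : regard p (^ sigma (^ tau X)) a) : fiso (induced_target e e' z).
Proof.
apply: fiso_cmp; first by apply: fiso_fun; apply: fst_twist_iso.
apply: fiso_cmp.
  exact: (tcomp_inv (retarget (F := mu M) e' (alpha M sigma^-1 tau^-1)) _).
apply: fiso_cmp; last exact: (tcomp_inv (theta sigma)
    (regard_functor p (pullback_functor (A sigma) (f tau)) a z)).
exact: (fiso_fun (mu M sigma^-1) (tcomp_inv (theta tau)
  (pullback_fst (lact_over A sigma) (pullback (A tau) X) a z))).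
Qed.

(** Four naturality squares side by side: those of [fst_twist], of alpha, of [theta tau] under
    [mu M sigma^-1], and of [theta sigma]. *)
Lemma induced_target_nat tau sigma rho (e : tau * sigma = rho) e' a b
    (z : regard p (^ sigma (^ tau X)) a)
    (y : regard p (^ sigma (^ tau X)) b) (g : fhom z y) :
  induced_target e e' y
    ∙ fun_hom (regard_functor p (f sigma ∘F pullback_functor (A sigma) (f tau))) g =
  fun_hom (action_functor A M rho) (fun_hom (regard_functor p (twist_can A e X)) g)
    ∙ induced_target e e' z.
Proof.
pose g1 := fun_hom (fst sigma (^ tau X)) g; pose g2 := fun_hom (fst tau X) g1.
apply: (square_paste (g := fun_hom (mu M rho^-1) g2)).
  rewrite -[LHS]fun_cmp (fst_twist_nat e g); exact: fun_cmp.
apply: (square_paste (g := fun_hom (mu M sigma^-1 ∘F mu M tau^-1) g2)).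
  exact: (tcomp_nat (retarget (F := mu M) e' (alpha M sigma^-1 tau^-1)) g2).
apply: (square_paste (g := fun_hom (mu M sigma^-1)
                             (fun_hom (regard_functor p (f tau)) g1))).
  rewrite -[LHS]fun_cmp (tcomp_nat (theta tau) g1); exact: fun_cmp.
exact: (tcomp_nat (theta sigma)
  (fun_hom (regard_functor p (pullback_functor (A sigma) (f tau))) g)).
Qed.

Lemma induced_target_proj tau sigma rho (e : tau * sigma = rho) e' a
  (z : regard p (^ sigma (^ tau X)) a) :
  fproj (induced_target e e' z) = id_hom a.
Proof.
rewrite /induced_target !fproj_cmp !fun_proj.
rewrite (tcomp_proj (theta tau) (fst sigma (^ tau X) a z)).
rewrite (tcomp_proj (theta sigma)
          (regard_functor p (pullback_functor (A sigma) (f tau)) a z)).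
rewrite (tcomp_proj (retarget (F := mu M) e' _)) !cmpm1.
by apply: slice_hom_eq; rewrite /= fproj_id.
Qed.

Lemma induced_psi tau sigma :
  {psi : two_iso (f sigma ∘F pullback_functor (A sigma) (f tau))
                 (f (tau * sigma) ∘F twist_can A (erefl (tau * sigma)) X)
  | forall a (z : regard p (^ sigma (^ tau X)) a),
    theta (tau * sigma) a (regard_functor p (twist_can A (erefl _) X) a z)
      ∙ regard_two_iso p psi a z
    = induced_target (erefl _) (esym (invMg tau sigma)) z}.
Proof.
set F := f sigma ∘F _; set can := twist_can A _ X.
pose H := action_functor A M (tau * sigma) ∘F regard_functor p can.
(* [r] is [theta (tau * sigma)] whiskered with the identification [can]; psi is the factor of [t]
   through it. *)
pose r := @TwoIso _ _ _ (regard_functor p (f (tau * sigma) ∘F can)) H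
  (fun a z => theta (tau * sigma) a (regard_functor p can a z))
  (fun a z => tcomp_proj (theta (tau * sigma)) (regard_functor p can a z))
  (fun a b z y g => tcomp_nat (theta (tau * sigma)) (fun_hom (regard_functor p can) g))
  (fun a z => tcomp_inv (theta (tau * sigma)) (regard_functor p can a z)).
pose t := @TwoIso _ _ _ (regard_functor p F) H
  (fun a z => induced_target (erefl _) (esym (invMg tau sigma)) z)
  (fun a z => induced_target_proj (erefl _) (esym (invMg tau sigma)) z)
  (fun a b z y g => induced_target_nat (erefl _) (esym (invMg tau sigma)) g)
  (fun a z => induced_target_iso (erefl _) (esym (invMg tau sigma)) z).
exact: (two_iso_of_regard_factor r t).
Qed.

Variable psi : forall tau sigma,
  two_iso (f sigma ∘F pullback_functor (A sigma) (f tau))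
          (f (tau * sigma) ∘F twist_can A (erefl (tau * sigma)) X).
Hypothesis psiE : forall tau sigma a (z : regard p (^ sigma (^ tau X)) a),
    theta (tau * sigma) a (regard_functor p (twist_can A (erefl _) X) a z)
      ∙ regard_two_iso p (psi tau sigma) a z
    = induced_target (erefl _) (esym (invMg tau sigma)) z.

Lemma psi_alongE tau sigma rho (e : tau * sigma = rho) e' a
    (z : regard p (^ sigma (^ tau X)) a) :
  theta rho a (regard_functor p (twist_can A e X) a z)
    ∙ regard_two_iso p (psi_along psi e) a z
  = induced_target e e' z.
Proof.
by case: rho / e e' => e'; rewrite (Prop_irrelevance e' (esym (invMg tau sigma))) psiE.
Qed.

Lemma psi_cocycle : two_descent_cocycle psi.
Proof.
move=> gamma tau sigma a0 z0.
pose a := SliceObj (p ∘ sstr a0).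
pose z : regard p (^ sigma (^ tau (^ gamma X))) a := to_regard p z0.
move=> w0 w0' assoc.
pose w : regard p (^ (tau * sigma) (^ gamma X)) a :=
  regard_functor p (twist_can A (erefl (tau * sigma)) (^ gamma X)) a z.
pose w' : regard p (^ sigma (^ (gamma * tau) X)) a :=
  regard_functor p
    (pullback_functor (A sigma) (twist_can A (erefl (gamma * tau)) X)) a z.
pose rho := gamma * tau * sigma.
pose v := regard_functor p (twist_can A (mulgA gamma tau sigma) X) a w.
pose v' := regard_functor p (twist_can A (erefl rho) X) a w'.
pose assocr : fhom v v' := assoc.
pose y := regard_functor p
  (pullback_functor (A sigma) (pullback_functor (A tau) (f gamma))) a z.
pose z1 := fst sigma (^ tau (^ gamma X)) a z.
pose z2 := fst tau (^ gamma X) a z1.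
pose z3 := fst gamma X a z2.
pose psi_z1 := regard_two_iso p (psi gamma tau) a z1.
have inv_rho : (tau * sigma)^-1 * gamma^-1 = rho^-1 by rewrite !invMg mulgA.
(* [e1] to [e6] rewrite the left composite, after theta, as identifications of pull-backs following
   two alphas following the thetas of [gamma], [tau] and [sigma]. *)
have e1 := tcomp_nat (theta rho) assocr.
have e2 := psi_alongE (mulgA gamma tau sigma) inv_rho w.
have e3 := psiE y.
have e4 : fun_hom (mu M (tau * sigma)^-1)
      (theta gamma a (fst (tau * sigma) (^ gamma X) a w))
      ∙ fun_hom (mu M (tau * sigma)^-1) (fst_twist (erefl (tau * sigma)) y) =
    fun_hom (mu M (tau * sigma)^-1) (fun_hom (mu M gamma^-1)
      (fun_hom (fst gamma X) (fst_twist (erefl (tau * sigma)) z)))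
      ∙ fun_hom (mu M (tau * sigma)^-1) (theta gamma a z2).
  rewrite -[LHS]fun_cmp -[RHS]fun_cmp; congr fun_hom.
  apply: etrans (tcomp_nat (theta gamma) (fst_twist (erefl (tau * sigma)) z)).
  (* Both [fst_twist] morphisms are identities, and [f gamma] sends the one at [z] to the one at
     [y]. *)
  congr (_ ∙ _); exact: (esym (fun_id (f gamma) _)).
have e5 := tcomp_nat (retarget (F := mu M) (esym (invMg tau sigma))
  (alpha M sigma^-1 tau^-1)) (theta gamma a z2).
have e6 := tcomp_nat (retarget (F := mu M) inv_rho (alpha M (tau * sigma)^-1 gamma^-1))
  (fun_hom (fst gamma X) (fst_twist (erefl (tau * sigma)) z)).
(* [e7] to [e10] bring the right composite to the same shape, with the same three thetas. *)
have e7 := psiE w'.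
have e8 := tcomp_nat (theta sigma)
  (regard_two_iso p (pullback_two_iso (A sigma) (psi gamma tau)) a z).
have e9 : fun_hom (mu M sigma^-1) (theta (gamma * tau) a
      (fst sigma (^ (gamma * tau) X) a w')) ∙ fun_hom (mu M sigma^-1) psi_z1 =
    fun_hom (mu M sigma^-1)
      (fun_hom (mu M (gamma * tau)^-1) (fst_twist (erefl (gamma * tau)) z1))
    ∙ (fun_hom (mu M sigma^-1) (retarget (F := mu M) (esym (invMg gamma tau))
         (alpha M tau^-1 gamma^-1) a z3)
      ∙ (fun_hom (mu M sigma^-1) (fun_hom (mu M tau^-1) (theta gamma a z2))
         ∙ fun_hom (mu M sigma^-1) (theta tau a (fst sigma (^ tau X) a y)))).
  rewrite -[LHS]fun_cmp -!fun_cmp; congr fun_hom; exact: psiE.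
have e10 := tcomp_nat (retarget (F := mu M) (esym (invMg (gamma * tau) sigma))
  (alpha M sigma^-1 (gamma * tau)^-1)) (fst_twist (erefl (gamma * tau)) z1).
(* Every factor is the image under [mu M rho^-1] of an identity of [X]. *)
have e11 : fun_hom (action_functor A M rho) assocr
      ∙ (fun_hom (mu M rho^-1) (fst_twist (mulgA gamma tau sigma) w)
         ∙ fun_hom (mu M rho^-1)
             (fun_hom (fst gamma X) (fst_twist (erefl (tau * sigma)) z))) =
    fun_hom (mu M rho^-1) (fst_twist (erefl rho) w')
      ∙ fun_hom (mu M rho^-1) (fst_twist (erefl (gamma * tau)) z1).
  rewrite -[X in _ ∙ X]fun_cmp -[LHS]fun_cmp -[RHS]fun_cmp; congr fun_hom.
  by rewrite /= !fcmp1m.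
(* Inversion reverses products, so associativity is taken at [sigma^-1], [tau^-1], [gamma^-1]. *)
have e12 := alpha_assoc_along inv_rho (esym (invMg tau sigma))
  (esym (invMg (gamma * tau) sigma)) (esym (invMg gamma tau)) z3.
(* At [to_regard p z0] the regarded functors compute to the original ones, so this is the goal up to
   conversion, now in a form where theta can be composed. *)
suff : fun_hom (regard_functor p (f rho)) assocr
      ∙ (regard_two_iso p (psi_along psi (mulgA gamma tau sigma)) a w
         ∙ regard_two_iso p (psi tau sigma) a y) =
    regard_two_iso p (psi (gamma * tau) sigma) a w' ∙ fun_hom (regard_functor p (f sigma))
      (regard_two_iso p (pullback_two_iso (A sigma) (psi gamma tau)) a z) by [].
apply: (fiso_monic (tcomp_inv (theta rho) v')).
apply: etrans (paste_left e1 e2 e3 e4 (esym e5) e6) _.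
apply: etrans (paste_congr _ e11 e12) _.
exact: esym (paste_right e7 e8 e9 e10).
Qed.

End Cocycle.

(** * Existence and comparison of induced data *)

Lemma induced_datum_exists :
  exists (D : galois_2descent_datum A X)
    (theta : forall sigma,
       two_iso (regard_functor p (gf D sigma)) (action_functor A M sigma)),
    induced_by_action theta.
Proof.
pose F sigma := functor_of_regard (@action_functor_str sigma).
pose f sigma := projT1 (F sigma).
pose theta sigma : two_iso (regard_functor p (f sigma)) (action_functor A M sigma) :=
  projT2 (F sigma).
have f_equiv sigma : is_equivalence (f sigma).
  apply: (@is_equivalence_of_regard _ _ _ p).
  exact: is_equivalence_two_iso (theta sigma) (is_equivalence_action_functor sigma).
pose psi tau sigma := sval (induced_psi theta tau sigma).
have psiE tau sigma := svalP (induced_psi theta tau sigma).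
by exists (GaloisDatum f_equiv (psi_cocycle psiE)), theta => tau sigma a z; apply: psiE.
Qed.

Lemma induced_comparison (D D' : galois_2descent_datum A X)
    (theta : forall sigma,
       two_iso (regard_functor p (gf D sigma)) (action_functor A M sigma))
    (theta' : forall sigma,
       two_iso (regard_functor p (gf D' sigma)) (action_functor A M sigma))
    (chi : forall sigma, two_iso (gf D sigma) (gf D' sigma)) :
  induced_by_action theta -> induced_by_action theta' ->
  (forall sigma a (x : regard p (^ sigma X) a),
     theta' sigma a x ∙ regard_two_iso p (chi sigma) a x = theta sigma a x) ->
  datum_iso chi.
Proof.
move=> ind ind' chiE tau sigma a0 z0.
pose a := SliceObj (p ∘ sstr a0).
pose z : regard p (^ sigma (^ tau X)) a := to_regard p z0.
pose w := regard_functor p (twist_can A (erefl (tau * sigma)) X) a z.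
pose y' := regard_functor p (pullback_functor (A sigma) (gf D' tau)) a z.
pose chi_z := regard_two_iso p (pullback_two_iso (A sigma) (chi tau)) a z.
have e1 := chiE (tau * sigma) a w.
have e2 := ind tau sigma a z.
have e3 := ind' tau sigma a z.
have e4 := chiE sigma a y'.
have e5 := tcomp_nat (theta sigma) chi_z.
have e6 : fun_hom (mu M sigma^-1) (theta' tau a (fst sigma (^ tau X) a z))
    ∙ fun_hom (mu M sigma^-1) (regard_two_iso p (chi tau) a (fst sigma (^ tau X) a z)) =
    fun_hom (mu M sigma^-1) (theta tau a (fst sigma (^ tau X) a z)).
  by rewrite -[LHS]fun_cmp chiE.
suff : regard_two_iso p (chi (tau * sigma)) a w
      ∙ regard_two_iso p (gpsi D tau sigma) a z =
    regard_two_iso p (gpsi D' tau sigma) a z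
      ∙ (regard_two_iso p (chi sigma) a y'
         ∙ fun_hom (regard_functor p (gf D sigma)) chi_z) by [].
apply: (fiso_monic (tcomp_inv (theta' (tau * sigma)) w)).
exact: (paste_comparison e1 e2 e3 e4 e5 e6).
Qed.

End Descent.

(** Canonicity is read as uniqueness of the pair of a datum and its theta, up to a unique family of
    2-isomorphisms compatible with both thetas. *)
Theorem lemma3p8 (S S' : Sch) (pi : hom S' S)
  (pi_surjective : surjective_hom pi) (pi_finite : finite_hom pi)
  (pi_etale : etale_hom pi)
  (Gamma : finGroupType) (A : left_action pi Gamma) (pi_galois : is_galois A)
  (X : cat_over (slice S')) (X_stack : stack_over X)
  (M : group_action Gamma (regard pi X)) (M_square : compatible_action A M) :
  (exists (D : galois_2descent_datum A X)
     (theta : forall sigma,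
        two_iso (regard_functor pi (gf D sigma)) (action_functor A M sigma)),
     induced_by_action theta) /\
  (forall (D D' : galois_2descent_datum A X)
     (theta : forall sigma,
        two_iso (regard_functor pi (gf D sigma)) (action_functor A M sigma))
     (theta' : forall sigma,
        two_iso (regard_functor pi (gf D' sigma)) (action_functor A M sigma)),
     induced_by_action theta -> induced_by_action theta' ->
     exists chi : forall sigma, two_iso (gf D sigma) (gf D' sigma),
       [/\ datum_iso chi,
           forall sigma a (x : regard pi (pullback (A sigma) X) a),
             theta' sigma a x ∙ regard_two_iso pi (chi sigma) a x = theta sigma a x &
           forall chi' : (forall sigma, two_iso (gf D sigma) (gf D' sigma)),
             (forall sigma a (x : regard pi (pullback (A sigma) X) a),
                theta' sigma a x ∙ regard_two_iso pi (chi' sigma) a x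
                = theta sigma a x) ->
             forall sigma a (x : pullback (A sigma) X a),
               chi' sigma a x = chi sigma a x]).
Proof.
split; first exact: induced_datum_exists.
move=> D D' theta theta' ind ind'.
have c sigma := two_iso_of_regard_factor (theta' sigma) (theta sigma).
pose chi sigma := sval (c sigma).
have chiE sigma a x : theta' sigma a x ∙ regard_two_iso pi (chi sigma) a x
  = theta sigma a x := svalP (c sigma) a x.
exists chi; split=> //; first exact: (induced_comparison ind ind').
(* Uniqueness: [chi'] and [chi] agree after composition with a component of [theta'], which is
   invertible and hence cancels. *)
move=> chi' chi'E sigma a x; have x_iso := tcomp_inv (theta' sigma) (to_regard pi x).
exact: (fiso_monic x_iso (etrans (chi'E _ _ (to_regard pi x)) (esym (chiE _ _ _)))).
Qed.
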